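(* Any $\mathcal{A}\mathrm{LR}$-algebra is an $\mathcal{A}\mathrm{BD}$-algebra.
   Context: All algebras are over $\mathbb{C}$; an algebra $(A,\cdot)$ is a vector space with a bilinear (not necessarily associative) multiplication. Write $x\circ y = x\cdot y+y\cdot x$. An $\mathcal{A}\mathrm{LR}$-algebra (antibicommutative algebra) is an algebra satisfying $x\cdot(y\cdot z)+y\cdot(x\cdot z)=0$ and $(x\cdot y)\cdot z+(x\cdot z)\cdot y=0$ for all $x,y,z$. An algebra $(A,\cdot)$ is called an $\mathcal{A}\mathrm{BD}$-algebra (algebra of anti-biderivation-type) if for all $x,y,z\in A$: $x\cdot(y\circ z) = -\big((x\cdot y)\circ z+y\circ(x\cdot z)\big)$ and $(y\circ z)\cdot x=-\big((y\cdot x)\circ z+y\circ(z\cdot x)\big)$. *)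

(* Defs.v *)
From mathcomp Require Import all_boot all_order all_algebra.
From mathcomp Require Import reals complex.

Set Implicit Arguments.
Unset Strict Implicit.
Unset Printing Implicit Defensive.

Local Open Scope ring_scope.

(* A complex algebra, possibly nonassociative, without unit and of infinite
   dimension, is a module A : lmodType R[i], with R a model of the real numbers,
   together with a product mul : {bilinear A -> A -> A}. The definitions below
   are identities on mul alone and do not mention the scalars. *)

Definition circ (A : zmodType) (mul : A -> A -> A) (x y : A) : A :=
  mul x y + mul y x.

(* Antibicommutative algebras. *)
Definition is_ALR (A : zmodType) (mul : A -> A -> A) : Prop :=
  forall x y z : A,
    mul x (mul y z) + mul y (mul x z) = 0 /\
    mul (mul x y) z + mul (mul x z) y = 0.

(* Algebras of anti-biderivation-type. *)
Definition is_ABD (A : zmodType) (mul : A -> A -> A) : Prop :=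
  forall x y z : A,
    mul x (circ mul y z)
      = - (circ mul (mul x y) z + circ mul y (mul x z)) /\
    mul (circ mul y z) x
      = - (circ mul (mul y x) z + circ mul y (mul z x)).

(* Main.v *)
Require Import Defs.
From mathcomp Require Import all_boot all_order all_algebra.
From mathcomp Require Import reals complex.

Import GRing.Theory.

Local Open Scope ring_scope.

(** Left multiplications anticommute, and so do right ones. In each identity one law carries the two
    left-hand terms to two of the four on the right; the other law makes the remaining two
    cancel. *)

Theorem corollary46 (R : realType) (A : lmodType R[i])
    (mul : {bilinear A -> A -> A}) :
  is_ALR mul -> is_ABD mul.
Proof.
move=> alr.
have mulNCA x y z : mul x (mul y z) = - mul y (mul x z).
  by apply/eqP; rewrite -addr_eq0 (alr x y z).1.
have mulNAC x y z : mul (mul x y) z = - mul (mul x z) y.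
  by apply/eqP; rewrite -addr_eq0 (alr x y z).2.
move=> x y z; rewrite /circ; split.
(* The cancelling pair is [(xy)z = -(xz)y]. *)
- rewrite linearDr (mulNCA x y z) (mulNCA x z y) (mulNAC x y z).
  by rewrite -opprD [in RHS]addrC addrA addrK.
(* The laws swap roles: the cancelling pair is [z(yx) = -y(zx)]. *)
- rewrite linearDl (mulNAC y z x) (mulNAC z y x) (mulNCA z y x).
  by rewrite -opprD addrA addrNK.
Qed.
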